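(* Let $n\ge 1$, let $Q\in\mathbb{R}^{n\times n}$, and let $\mathsf{P}$ be the set of $n\times n$ permutation matrices. Let $\boldsymbol{X}$ be a random vector uniformly distributed in the unit hypercube $H=[0,1]^n$. Then $$\arg\min_{P\in\mathsf{P}}\|Q-P\|_{\rm F}^2=\arg\min_{P\in\mathsf{P}}E\left(\|Q\boldsymbol{X}-P\boldsymbol{X}\|_{\rm F}^2\right).$$
   Context: $\|A\|_{\rm F}=[\mathrm{tr}(AA^H)]^{1/2}$ is the Frobenius norm; on column vectors it is the Euclidean norm. $\mathsf{P}=\{P\in\mathbb{R}^{n\times n}:P\mathbf{1}=P^T\mathbf{1}=\mathbf{1},\ P_{ij}\in\{0,1\}\}$, where $\mathbf{1}$ is the all-ones vector. $\arg\min$ denotes the set of all minimisers, so the claim is an equality of subsets of $\mathsf{P}$. $E$ denotes expectation. *)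

(* Defs.v *)
From HB Require Import structures.
From mathcomp Require Import all_boot all_order all_algebra.
From mathcomp Require Import all_classical all_reals all_analysis.
From mathcomp Require Import measurable_realfun.

Set Implicit Arguments.
Unset Strict Implicit.
Unset Printing Implicit Defensive.

Import Order.TTheory GRing.Theory Num.Theory.
Import numFieldNormedType.Exports.

Local Open Scope classical_set_scope.
Local Open Scope ring_scope.

(* For real matrices the conjugate transpose is the transpose. *)
Definition frobenius_norm (R : realType) (m n : nat) (A : 'M[R]_(m, n)) : R :=
  Num.sqrt (\tr (A *m A^T)).

Definition permutation_matrices (R : realType) (n : nat) : set 'M[R]_n :=
  [set P | [/\ P *m const_mx 1 = const_mx 1 :> 'cV[R]_n,
               P^T *m const_mx 1 = const_mx 1 :> 'cV[R]_n &
               forall i j, P i j = 0 \/ P i j = 1]].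

Definition argmin (V : Type) (d : Order.disp_t) (W : porderType d)
    (S : set V) (f : V -> W) : set V :=
  [set x | S x /\ forall y, S y -> (f x <= f y)%O].

(* n-dimensional Lebesgue measure as an iterated integral, one coordinate at a
   time; in dimension 0 it is the unit mass at the empty tuple. *)
Fixpoint volume (R : realType) (n : nat) : set (n.-tuple R) -> \bar R :=
  match n with
  | 0 => fun A => \d_([tuple]) A
  | n'.+1 => fun A =>
      (\int[lebesgue_measure]_x
         volume [set t : n'.-tuple R | A [tuple of x :: t]])%E
  end.

Lemma volume0 (R : realType) (n : nat) : volume (set0 : set (n.-tuple R)) = 0%E.
Proof.
elim: n => [|n IHn] /=; first by rewrite diracE in_set0.
rewrite -[LHS]/(\int[lebesgue_measure]_x volume (set0 : set (n.-tuple R)))%E.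
by rewrite IHn integral0.
Qed.

Lemma volume_box (R : realType) n (B : 'I_n -> set R) :
  (forall i, measurable (B i)) ->
  volume [set t : n.-tuple R | forall i, B i (tnth t i)] =
  (\prod_(i < n) lebesgue_measure (B i))%E.
Proof.
elim: n B => [|n IH] B mB.
  rewrite big_ord0 /= diracE mem_set //=; by case.
rewrite big_ord_recl /=.
have E x : volume [set t : n.-tuple R | forall i, B i (tnth [tuple of x :: t] i)]
  = ((\1_(B ord0) x)%:E * \prod_(i < n) lebesgue_measure (B (lift ord0 i)))%E.
  rewrite indicE; have [xB|xB] := boolP (x \in B ord0).
    rewrite mul1e -IH; last by move=> i; exact: mB.
    congr volume; apply/seteqP; split=> t /= H i.
      by have := H (lift ord0 i); rewrite tnthS.
    by case: (unliftP ord0 i) => [j ->|->]; rewrite ?tnthS ?tnth0 //; exact/set_mem.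
  rewrite mul0e.
  have -> : [set t : n.-tuple R | forall i, B i (tnth [tuple of x :: t] i)] = set0.
    apply/seteqP; split=> t //= /(_ ord0); rewrite tnth0 => h.
    by move/negP: xB; apply; exact/mem_set.
  exact: volume0.
under eq_integral do rewrite E.
have c0 : (0 <= \prod_(i < n) lebesgue_measure (B (lift ord0 i)))%E.
  by apply: prode_ge0 => i _; exact: measure_ge0.
rewrite ge0_integralZr //.
- by rewrite integral_indic ?setIT //; exact: mB.
- by apply/measurable_EFinP; apply: measurable_indic; exact: mB.
Qed.

Definition hypercube (R : realType) (n : nat) : set (n.-tuple R) :=
  [set t | forall i, 0 <= tnth t i <= 1].

Lemma volume_hypercube (R : realType) n : volume (@hypercube R n) = 1%E.
Proof.
have -> : @hypercube R n = [set t | forall i, `[0:R, 1]%classic (tnth t i)].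
  by apply/seteqP; split=> t /= H i; have := H i; rewrite /= in_itv.
rewrite (volume_box (B := fun=> `[0:R, 1]%classic)) // big1 // => i _.
by rewrite lebesgue_measure_itv /= lte_fin ltr01 oppr0 adde0.
Qed.

(* The sigma-algebra on [n.-tuple R] is generated by the coordinates, that is,
   the Borel one. *)
Definition uniform_in (R : realType) (d : measure_display)
    (T : measurableType d) (Pr : probability T R) (n : nat)
    (H : set (n.-tuple R)) (X : {RV Pr >-> n.-tuple R}) : Prop :=
  forall A : set (n.-tuple R), measurable A ->
    distribution Pr X A = (volume (A `&` H) / volume H)%E.

Definition col_of_tuple (R : realType) (n : nat) (t : n.-tuple R) : 'cV[R]_n :=
  \col_i tnth t i.

(* Main.v *)
(** Distinct coordinates of [X] are independent and uniform on [[0, 1]], so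
    [E (X_j X_k)] is [1/3] if [j = k] and [1/4] otherwise; hence
    [E |M X|^2 = |M|^2 / 12 + |M 1|^2 / 4] for every matrix [M].  For
    [M = Q - P] with [P] a permutation matrix, [M 1 = Q 1 - 1] does not depend
    on [P]: the two objective functions differ by an increasing affine map. *)
Require Import Defs.
From HB Require Import structures.
From mathcomp Require Import all_boot all_order all_algebra.
From mathcomp Require Import all_classical all_reals all_analysis.
From mathcomp Require Import measurable_realfun ring lra.

Set Implicit Arguments.
Unset Strict Implicit.
Unset Printing Implicit Defensive.

Import Order.TTheory GRing.Theory Num.Theory.
Import numFieldNormedType.Exports.

Local Open Scope classical_set_scope.
Local Open Scope ring_scope.

(** * Powers on the unit interval, Frobenius norms, minimisers, the uniform law *)

Lemma integral_itv01_exprn (R : realType) (k : nat) :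
  (\int[lebesgue_measure]_(x in `[0%R, 1%R]) (x ^+ k)%:E = (k.+1%:R^-1 : R)%:E)%E.
Proof.
rewrite (@continuous_FTC2 _ _ (fun x : R => x ^+ k.+1 * k.+1%:R^-1)) //.
- by rewrite expr1n expr0n /= mul0r mul1r sube0.
- by apply: continuous_subspaceT => x; exact: exprn_continuous.
- have dX (x : R) : derivable (fun x : R => x ^+ k.+1 * k.+1%:R^-1) x 1.
    by apply: derivableM => //; exact: exprn_derivable.
  have cX : continuous (fun x : R => x ^+ k.+1 * k.+1%:R^-1).
    by move=> x; apply: cvgM; [exact: exprn_continuous | exact: cvg_cst].
  by split => [x _||]; [exact: dX | exact/cvg_at_right_filter/cX |
    exact/cvg_at_left_filter/cX].
- move=> x _; rewrite derive1Mr; last exact: exprn_derivable.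
  rewrite derive1E exp_derive.
  by rewrite /= scaler1 -mulr_natl mulrAC mulfV ?mul1r // pnatr_eq0.
Qed.

Lemma frobenius_norm_sqr (R : realType) m n (A : 'M[R]_(m, n)) :
  frobenius_norm A ^+ 2 = \sum_i \sum_j A i j ^+ 2.
Proof.
have -> : \sum_i \sum_j A i j ^+ 2 = \tr (A *m A^T).
  rewrite /mxtrace; apply: eq_bigr => i _; rewrite mxE.
  by apply: eq_bigr => j _; rewrite mxE expr2.
rewrite sqr_sqrtr // /mxtrace sumr_ge0 // => i _; rewrite mxE sumr_ge0 // => j _.
by rewrite mxE -expr2 sqr_ge0.
Qed.

(** Minimality depends only on comparisons between values on [S]. Two codomains are allowed because
    one objective is real and the other, an expectation, is extended real. *)
Lemma eq_argmin (V : Type) d d' (W : porderType d) (W' : porderType d')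
    (S : set V) (f : V -> W) (g : V -> W') :
  (forall x y, S x -> S y -> (f x <= f y)%O = (g x <= g y)%O) ->
  argmin S f = argmin S g.
Proof.
move=> fg; apply/seteqP; split => x [Sx H]; split=> // y Sy.
  by rewrite -fg // H.
by rewrite fg // H.
Qed.

(** The density is 1 on the unit interval. This identifies the factors that [volume_box] produces
    with uniform probabilities. *)
Lemma uniform_prob01E (R : realType) (A : set R) : measurable A ->
  uniform_prob (@ltr01 R) A = lebesgue_measure (A `&` `[0%R, 1%R]).
Proof.
move=> mA; rewrite /uniform_prob integral_uniform_pdf.
rewrite (eq_integral (fun=> 1%E)) ?integral_cst ?mul1e //.
- exact: measurableI.
- move=> x; rewrite inE /= in_itv /= => -[_ x01].
  by rewrite /uniform_pdf x01 subr0 invr1.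
Qed.

(** * Joint law and second moments of the coordinates *)

Section uniform_hypercube_moments.
Context (R : realType) (n : nat) (d : measure_display) (T : measurableType d)
  (Pr : probability T R) (X : {RV Pr >-> n.-tuple R}).
Hypothesis hX : uniform_in (@hypercube R n) X.

Local Notation U := (uniform_prob (@ltr01 R)).

(** The hypercube is itself a box of volume 1, so cutting a box by it gives a box again, whose
    volume factors, and the normalisation disappears. *)
Lemma uniform_box (B : 'I_n -> set R) : (forall i, measurable (B i)) ->
  Pr [set w | forall i, B i (tnth (X w) i)] = (\prod_(i < n) U (B i))%E.
Proof.
move=> mB.
have mA : measurable [set t : n.-tuple R | forall i, B i (tnth t i)].
  have -> : [set t : n.-tuple R | forall i, B i (tnth t i)] =
      \bigcap_(i in [set: 'I_n]) ((@tnth n R)^~ i @^-1` B i).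
    by apply/seteqP; split => t /= H i; [move=> _|]; exact: H.
  apply: fin_bigcap_measurable => // i _; rewrite -[X in measurable X]setTI.
  exact: measurable_tnth.
have := hX mA; rewrite /distribution /pushforward /preimage /= => ->.
rewrite volume_hypercube inve1 mule1.
have -> : [set t : n.-tuple R | forall i, B i (tnth t i)] `&` @hypercube R n =
    [set t | forall i, (B i `&` `[0%R, 1%R]) (tnth t i)].
  apply/seteqP; split => [t [BH tH] i|t H].
    by split; [exact: BH | rewrite /= in_itv; exact: tH].
  by split => i; have /= := H i; rewrite in_itv => -[].
rewrite (volume_box (B := fun i => B i `&` `[0%R, 1%R])); last first.
  by move=> i; exact: measurableI.
by apply: eq_bigr => i _; rewrite uniform_prob01E.
Qed.

(* [uniform_prob] lives on [measurableTypeR R]; its sigma-algebra is convertible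
   to the default one on [R], but carries another display. *)
Local Notation Borel := (measurableTypeR R).

Lemma measurable_coord i :
  measurable_fun setT (fun w => tnth (X w) i : Borel).
Proof. exact: (measurableT_comp (measurable_tnth i) (measurable_funPT X)). Qed.

Lemma measurable_coord_pair i j :
  measurable_fun setT (fun w => (tnth (X w) i, tnth (X w) j) : Borel * Borel).
Proof. by apply: measurable_fun_pair; exact: measurable_coord. Qed.

Let coord i : {RV Pr >-> Borel} := mfun_Sub (mem_set (measurable_coord i)).

Let coord_pair i j : {RV Pr >-> (Borel * Borel)%type} :=
  mfun_Sub (mem_set (measurable_coord_pair i j)).

Lemma uniform_coord i (A : set R) : measurable A ->
  distribution Pr (coord i) A = U A.
Proof.
(* Unconstrained coordinates get the whole line, which contributes a factor 1. *)
move=> mA; pose B (k : 'I_n) := if k == i then A else setT.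
have -> : distribution Pr (coord i) A =
    Pr [set w | forall k, B k (tnth (X w) k)].
  rewrite /distribution /pushforward; congr (Pr _); apply/seteqP; split => w /=.
    by move=> Aw k; rewrite /B; case: eqP => [->|].
  by move/(_ i); rewrite /B eqxx.
rewrite uniform_box; last by move=> k; rewrite /B; case: ifP.
rewrite (bigD1 i) //= big1 ?mule1 ?/B ?eqxx // => k /negbTE ->.
exact: probability_setT.
Qed.

(** Independence, stated on rectangles; [i != j] puts the two constraints on different sides of the
    box. *)
Lemma uniform_coords i j (A B : set R) :
    i != j -> measurable A -> measurable B ->
  distribution Pr (coord_pair i j) (A `*` B) = (U A * U B)%E.
Proof.
move=> ij mA mB.
pose C (k : 'I_n) := if k == i then A else if k == j then B else setT.
have -> : distribution Pr (coord_pair i j) (A `*` B) =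
    Pr [set w | forall k, C k (tnth (X w) k)].
  rewrite /distribution /pushforward; congr (Pr _); apply/seteqP; split => w /=.
    by move=> [Aw Bw] k; rewrite /C; case: eqP => [->//|_]; case: eqP => [->|].
  move=> H; have := H i; have := H j.
  by rewrite /C !eqxx eq_sym (negbTE ij).
rewrite uniform_box; last by move=> k; rewrite /C; do 2?case: ifP.
rewrite (bigD1 i) //= (bigD1 j) 1?eq_sym //= big1 => [|k /andP[ki kj]].
  by rewrite mule1 /C eqxx eq_sym (negbTE ij) eqxx.
by rewrite /C (negbTE ki) (negbTE kj); exact: probability_setT.
Qed.

(* Absolute values make the integrand nonnegative on the whole line, so that
   change of variables and Tonelli apply without integrability hypotheses. *)
Lemma integral_uniform01_abs_exprn k :
  (\int[U]_x (`|x| ^+ k)%:E = (k.+1%:R^-1)%:E)%E.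
Proof.
rewrite integral_uniform; first last.
- by move=> x; rewrite lee_fin exprn_ge0.
- by apply/measurable_EFinP; apply: measurable_funX; exact: normr_measurable.
rewrite subr0 invr1 mul1e -integral_itv01_exprn; apply: eq_integral => x.
by rewrite inE /= in_itv /= => /andP[x0 _]; rewrite ger0_norm.
Qed.

(** The value of E(X_i X_j): the second moment 1/3 of the uniform law, or the product (1/2)(1/2) of
    two means. *)
Let c (i j : 'I_n) : R := if i == j then 3^-1 else 4^-1.

Lemma integral_abs_coords i j :
  (\int[Pr]_w (`|tnth (X w) i| * `|tnth (X w) j|)%:E = (c i j)%:E)%E.
Proof.
rewrite /c; case: eqVneq => [<-|ij].
  rewrite -integral_uniform01_abs_exprn.
  transitivity (\int[distribution Pr (coord i)]_x (`|x| ^+ 2)%:E)%E.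
    rewrite ge0_integral_distribution //.
    by apply/measurable_EFinP; apply: measurable_funX; exact: normr_measurable.
  by apply: eq_measure_integral => A mA _; exact: uniform_coord.
pose f (z : Borel * Borel) : \bar R := (`|z.1| * `|z.2|)%:E.
have mf : measurable_fun setT f.
  by apply/measurable_EFinP; apply: measurable_funM;
    apply: measurableT_comp => //; exact: normr_measurable.
have f0 z : (0 <= f z)%E by rewrite lee_fin mulr_ge0.
transitivity (\int[distribution Pr (coord_pair i j)]_z f z)%E.
  by rewrite ge0_integral_distribution.
(* The joint law agrees with [U \x U] on rectangles, hence everywhere; Tonelli then separates the
   two factors. *)
rewrite -(@eq_measure_integral _ _ _ _ _ (U \x U)%E); last first.
  move=> A mA _; apply: product_measure_unique => // B C mB mC.
  exact: uniform_coords.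
rewrite fubini_tonelli1 //.
have E x : fubini_F U f x = (`|x|%:E * (2^-1)%:E)%E.
  rewrite /fubini_F /f -(integral_uniform01_abs_exprn 1) -ge0_integralZl //.
    by apply/measurable_EFinP; exact: normr_measurable.
under eq_integral do rewrite E.
rewrite ge0_integralZr //; last first.
  by apply/measurable_EFinP; exact: normr_measurable.
rewrite (integral_uniform01_abs_exprn 1) -EFinM; congr EFin.
by rewrite -invfM -natrM.
Qed.

(** The hypothesis fixes only the law of [X], so a coordinate may be negative on a null set. This is
    what removes the absolute values in [integral_coords]. *)
Lemma coord_ge0_ae i : {ae Pr, forall w, 0 <= tnth (X w) i}.
Proof.
exists ((fun w => tnth (X w) i) @^-1` `]-oo, 0[); split.
- rewrite -[X in measurable X]setTI; exact: measurable_coord.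
- have := uniform_coord i (measurable_itv `]-oo, 0[).
  rewrite /distribution /pushforward => ->; rewrite uniform_prob01E //.
  have -> : `]-oo, 0%R[ `&` `[0%R, 1%R] = set0 :> set R.
    by apply/seteqP; split => x //=; rewrite !in_itv /=; lra.
  exact: measure0.
- by move=> w /= /negP; rewrite -ltNge in_itv.
Qed.

Lemma measurable_coords i j :
  measurable_fun setT (fun w => (tnth (X w) i * tnth (X w) j)%:E).
Proof. by apply/measurable_EFinP/measurable_funM; exact: measurable_coord. Qed.

Lemma integrable_coords i j :
  Pr.-integrable setT (fun w => (tnth (X w) i * tnth (X w) j)%:E).
Proof.
apply/integrableP; split; first exact: measurable_coords.
under eq_integral do rewrite /= normrM.
by rewrite integral_abs_coords ltry.
Qed.

Lemma integral_coords i j :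
  (\int[Pr]_w (tnth (X w) i * tnth (X w) j)%:E = (c i j)%:E)%E.
Proof.
rewrite -integral_abs_coords; apply: ae_eq_integral => //.
- exact: measurable_coords.
- by apply/measurable_EFinP/measurable_funM;
    apply: measurableT_comp (measurable_coord _) => //; exact: normr_measurable.
- apply: filterS2 (coord_ge0_ae i) (coord_ge0_ae j) => w Xi Xj _.
  by rewrite !ger0_norm.
Qed.

(** * Expected squared norm of a linear image *)

Lemma expectation_sqr_norm_mulmx m (M : 'M[R]_(m, n)) :
  ('E_Pr[fun w => (frobenius_norm (M *m col_of_tuple (X w)) ^+ 2)%R] =
   (12^-1 * frobenius_norm M ^+ 2 +
    4^-1 * frobenius_norm (M *m (const_mx 1 : 'cV_n)) ^+ 2)%:E)%E.
Proof.
rewrite unlock.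
transitivity (\int[Pr]_w (\sum_i \sum_j \sum_k
    (M i j * M i k)%:E * (tnth (X w) j * tnth (X w) k)%:E))%E.
  apply: eq_integral => w _; rewrite frobenius_norm_sqr -sumEFin.
  apply: eq_bigr => i _; rewrite big_ord1 mxE expr2 mulr_suml -sumEFin.
  apply: eq_bigr => j _; rewrite mulr_sumr -sumEFin.
  by apply: eq_bigr => k _; rewrite !mxE -EFinM mulrACA.
(* The entries of [M] may have any sign, so exchanging sums and integral rests on integrability
   rather than positivity. *)
have iXX i j k : Pr.-integrable setT
    (fun w => (M i j * M i k)%:E * (tnth (X w) j * tnth (X w) k)%:E)%E.
  exact/integrableZl/integrable_coords.
rewrite integral_sum // => [|i]; last by do 2 apply: integrable_sum => // ? _.
transitivity (\sum_i \sum_j \sum_k (M i j * M i k * c j k)%:E)%E.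
  apply: eq_bigr => i _; rewrite integral_sum // => [|j]; last first.
    exact: integrable_sum.
  apply: eq_bigr => j _; rewrite integral_sum //; apply: eq_bigr => k _.
  by rewrite integralZl ?integral_coords //; exact: integrable_coords.
rewrite !frobenius_norm_sqr !mulr_sumr -big_split /= -sumEFin.
apply: eq_bigr => i _; rewrite big_ord1 mxE.
under [X in (_ + 4^-1 * X ^+ 2)]eq_bigr do rewrite mxE mulr1.
rewrite expr2 mulr_suml !mulr_sumr -big_split /= -sumEFin.
apply: eq_bigr => j _; rewrite sumEFin; congr EFin.
(* The term [k = j] matches because 1/3 = 1/12 + 1/4; every other term has coefficient 1/4 on both
   sides. *)
rewrite 2!mulr_sumr (bigD1 j) //= [in RHS](bigD1 j) //= addrA; congr (_ + _).
  by rewrite /c eqxx; field.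
apply: eq_bigr => k kj; rewrite /c eq_sym (negbTE kj); ring.
Qed.

End uniform_hypercube_moments.

Theorem proposition3 (R : realType) (n : nat) (hn : (1 <= n)%N) (Q : 'M[R]_n)
    (d : measure_display) (T : measurableType d) (Pr : probability T R)
    (X : {RV Pr >-> n.-tuple R}) (hX : uniform_in (@hypercube R n) X) :
  argmin (@permutation_matrices R n)
    (fun P : 'M[R]_n => frobenius_norm (Q - P) ^+ 2) =
  argmin (@permutation_matrices R n)
    (fun P : 'M[R]_n =>
       'E_Pr[fun w => (frobenius_norm
         (Q *m col_of_tuple (X w) - P *m col_of_tuple (X w)) ^+ 2)%R]%E).
Proof.
have expE P : permutation_matrices P ->
    'E_Pr[fun w => (frobenius_norm
      (Q *m col_of_tuple (X w) - P *m col_of_tuple (X w)) ^+ 2)%R]%E =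
    (12^-1 * frobenius_norm (Q - P) ^+ 2 + 4^-1 *
     frobenius_norm (Q *m const_mx 1 - (const_mx 1 : 'cV_n)) ^+ 2)%:E.
  (* Since [P] fixes the all-ones vector, the constant term is the squared norm of
     [(Q - P) *m const_mx 1] in disguise, and the moment formula applies to [Q - P]. *)
  case=> P1 _ _; rewrite -{2}P1 -mulmxBl -(expectation_sqr_norm_mulmx hX).
  by congr expectation; apply/funext => w; rewrite mulmxBl.
apply: eq_argmin => P P' HP HP'.
by rewrite !expE // lee_fin lerD2r ler_pM2l ?invr_gt0.
Qed.
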